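(* Let $f$ be a cubic polynomial with real coefficients. Then for each $k\in\{1,2,3\}$ there exists a point $P$ of the plane, not on the graph of $f$, such that $I_f(P)=k$.
   Context: For a differentiable function $f$ on $\mathbb{R}$ and a point $P$ not on the graph of $f$, the illumination index $I_f(P)$ is the number of distinct lines that are tangent to the graph of $f$ (i.e. lines $y=f(c)+f'(c)(x-c)$ for some $c\in\mathbb{R}$) and pass through $P$; a line tangent at several points is counted once. The value $\infty$ is allowed in general. *)

(* Defs.v *)
From HB Require Import structures.
From mathcomp Require Import all_boot all_order all_algebra.
From mathcomp Require Import all_classical all_reals all_analysis.
Set Implicit Arguments.
Unset Strict Implicit.
Unset Printing Implicit Defensive.
Import Order.TTheory GRing.Theory Num.Theory.
Import numFieldNormedType.Exports.
Local Open Scope classical_set_scope.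
Local Open Scope ring_scope.

(* Points of the plane are pairs [P : R * R]; lines are sets of points, so that
   a line tangent to the graph at several abscissas is counted only once. *)

Definition plane_graph (R : realType) (f : R -> R) : set (R * R) :=
  [set P : R * R | P.2 = f P.1].

Definition tangent_line (R : realType) (f : R -> R) (c : R) : set (R * R) :=
  [set P : R * R | P.2 = f c + derive1 f c * (P.1 - c)].

Definition tangent_lines_through (R : realType) (f : R -> R) (P : R * R) :
    set (set (R * R)) :=
  [set L | range (tangent_line f) L /\ L P].

(* [counting] is the number of elements of a finite set, and [+oo] for an
   infinite set. The index is meant for [f] differentiable on [R] and [P] off
   the graph of [f]. *)
Definition illumination_index (R : realType) (f : R -> R) (P : R * R) : \bar R :=
  counting (tangent_lines_through f P).

(* Main.v *)
Require Import Defs.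
From mathcomp Require Import all_boot all_order all_algebra.
From mathcomp Require Import all_classical all_reals all_analysis.
From mathcomp Require Import finmap ring lra.
Import Order.TTheory GRing.Theory Num.Theory.
Local Open Scope classical_set_scope.
Local Open Scope ring_scope.

(** A tangent line through a given point is a solution of a cubic equation in
    the abscissa of tangency. Measured from the inflection abscissa m, the
    cubic reads a w^3 + q w + r, and its tangent at w takes at abscissa s the
    value (q s + r) + a (3 s w^2 - 2 w^3). So the point at abscissa s and
    height (q s + r) + a h lies on the tangent at w exactly when
    3 s w^2 - 2 w^3 = h, and it lies on the graph exactly when h = s^3. The
    coefficients of the cubic have disappeared from both conditions.

    Distinct abscissas of tangency give distinct lines: the tangent at w meets
    the vertical line through the inflection point at height r - 2 a w^3,
    and cubing is injective on the reals. The illumination index is therefore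
    the number of real roots w ([illumination_index_cubic]), and it remains
    to choose s and h with h <> s^3 and with one, two or three real roots. *)

Lemma counting_image_seq (T U : choiceType) (R : realType) (f : T -> U)
    (s : seq T) :
  injective f -> uniq s ->
  counting (f @` [set` s]) = (size s)%:R%:E :> \bar R.
Proof.
move=> f_inj s_uniq.
rewrite /counting asboolT; last exact/finite_image/finite_seq.
rewrite fset_set_image; last exact: finite_seq.
rewrite card_imfset //=.
have -> : [set` s] = [set` [fset x in s]%fset].
  by apply/seteqP; split=> x /=; rewrite !inE.
by rewrite set_fsetK card_fseq undup_id.
Qed.

(** Translating the abscissa by m = - b / (3 a) removes the quadratic term. The
    derivative is given along with the values because only these two enter the
    equations of the tangent lines. *)
Lemma cubic_about_inflection (R : realType) (p : {poly R}) :
  size p = 4%N ->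
  exists a q r m : R, a != 0 /\ forall w : R,
    p.[m + w] = a * w ^+ 3 + q * w + r /\
    derive1 (horner p) (m + w) = 3 * a * w ^+ 2 + q.
Proof.
move=> p4.
have a0 : p`_3 != 0 by rewrite -[3%N]/(4.-1)%N -p4 -lead_coefE lead_coef_eq0 -size_poly_eq0 p4.
have pE : p = p`_3 *: 'X^3 + p`_2 *: 'X^2 + p`_1 *: 'X + p`_0 *: 1.
  rewrite -[LHS]coefK poly_def p4 !big_ord_recr big_ord0 /= add0r expr0 expr1.
  ring.
move: {p4} p`_3 p`_2 p`_1 p`_0 a0 pE => a b c d a0 ->.
set f := _ + _.
have fE x : f.[x] = a * x ^+ 3 + b * x ^+ 2 + c * x + d.
  by rewrite /f !hornerE /=; ring.
have dfE x : derive1 (horner f) x = 3 * a * x ^+ 2 + 2 * b * x + c.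
  by rewrite -derive.derivE /f !poly.derivE !hornerE /=; ring.
pose m := - b / (3 * a).
exists a, (3 * a * m ^+ 2 + 2 * b * m + c),
  (a * m ^+ 3 + b * m ^+ 2 + c * m + d), m; split=> // w.
rewrite fE dfE /m.
by split; field.
Qed.

Lemma expr3_inj (R : realFieldType) : injective (fun x : R => x ^+ 3).
Proof.
move=> x y /eqP; rewrite -subr_eq0 => /eqP xy3.
have /eqP : (x - y) * (x ^+ 2 + x * y + y ^+ 2) = 0 by rewrite -xy3; ring.
rewrite mulf_eq0 subr_eq0 => /orP[/eqP // | /eqP xy0].
have := (sqr_ge0 x, sqr_ge0 y, sqr_ge0 (x + y)) => -[[x2 y2] xy2].
have /eqP : x ^+ 2 = 0 by lra.
have /eqP : y ^+ 2 = 0 by lra.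
by rewrite !expf_eq0 /= => /eqP -> /eqP ->.
Qed.

(** The parameters s and h are coordinates of the point adapted to the cubic:
    s is the abscissa relative to the inflection point, and a h is the height
    above the tangent line at the inflection point. The witness point is
    written in terms of them in the proof. *)
Lemma illumination_index_cubic (R : realType) (p : {poly R}) (s h : R)
    (ws : seq R) :
  size p = 4%N -> uniq ws -> s ^+ 3 != h ->
  (forall w, 3 * s * w ^+ 2 - 2 * w ^+ 3 = h <-> w \in ws) ->
  exists P : R * R, ~ plane_graph (horner p) P /\
    illumination_index (horner p) P = (size ws)%:R%:E.
Proof.
move=> /cubic_about_inflection[a [q [r [m [a0 pE]]]]] ws_uniq sh wsE.
have tangentE w x y : tangent_line (horner p) (m + w) (m + x, y) <->
    y = q * x + r + a * (3 * x * w ^+ 2 - 2 * w ^+ 3).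
  rewrite /tangent_line /= (pE w).1 (pE w).2.
  by split=> ->; ring.
exists (m + s, q * s + r + a * h); split.
  rewrite /plane_graph /= (pE s).1 => /eqP.
  rewrite -subr_eq0.
  have -> : q * s + r + a * h - (a * s ^+ 3 + q * s + r) = a * (h - s ^+ 3).
    by ring.
  by rewrite mulf_eq0 (negPf a0) subr_eq0 eq_sym (negPf sh).
have throughE w : tangent_line (horner p) (m + w) (m + s, q * s + r + a * h)
    <-> w \in ws.
  rewrite -wsE tangentE; split=> [/addrI /(mulfI a0) -> // | -> //].
rewrite /illumination_index.
have -> : tangent_lines_through (horner p) (m + s, q * s + r + a * h) =
    (fun w => tangent_line (horner p) (m + w)) @` [set` ws].
  apply/seteqP; split=> L /=.
    move=> [[c _ <-] cP]; exists (c - m); last by rewrite subrKC.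
    by apply/throughE; rewrite subrKC.
  by move=> [w /throughE wP <-]; split=> //; exists (m + w).
apply: counting_image_seq ws_uniq => v w vw.
(* Compare the two lines at the inflection abscissa, where the quadratic term
   of their height vanishes. *)
have /tangentE : tangent_line (horner p) (m + w)
    (m + 0, q * 0 + r + a * (3 * 0 * v ^+ 2 - 2 * v ^+ 3)).
  by rewrite -vw; apply/tangentE.
move=> /addrI /(mulfI a0) v3w3.
by apply: expr3_inj; lra.
Qed.

Theorem theorem3p1 (R : realType) (p : {poly R}) (hp : size p = 4%N)
  (k : nat) (hk : (1 <= k <= 3)%N) :
  exists P : R * R,
    ~ plane_graph (horner p) P /\
    illumination_index (horner p) P = (k%:R)%:E.
Proof.
case: k hk => [|[|[|[|]]]] // _.
(* At the inflection abscissa the equation is w^3 = 1. *)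
- apply: (@illumination_index_cubic _ _ 0 (- 2) [:: 1]) => //.
  + by apply/eqP; lra.
  move=> w; rewrite inE; split=> [w3 | /eqP ->]; last by lra.
  by apply/eqP/expr3_inj => /=; lra.
(* On the inflectional tangent (h = 0) the equation is w^2 (3 s - 2 w) = 0: the
   two tangents are the inflectional one, with double root 0, and one more. *)
- apply: (@illumination_index_cubic _ _ 2 0 [:: 0; 3]) => //.
  + by rewrite /= !inE andbT; apply/eqP; lra.
  move=> w; rewrite !inE; split=> [w0|]; last first.
    by move=> /orP[] /eqP ->; ring.
  have /eqP : w ^+ 2 * (w - 3) = 0 by lra.
  by rewrite mulf_eq0 expf_eq0 /= subr_eq0.
(* Three distinct numbers x, y, z are the roots for some s and h as soon as
   x y + y z + z x = 0; then 3 s = 2 (x + y + z) and h = - 2 x y z. An integral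
   solution comes from x : y : z = 3 : 6 : - 2, scaled by 3 to make s integral. *)
- apply: (@illumination_index_cubic _ _ 14 1944 [:: 9; 18; - 6]) => //.
  + by rewrite /= !inE !negb_or andbT -andbA; apply/and3P; split; apply/eqP; lra.
  + by apply/eqP; lra.
  move=> w; rewrite !inE; split=> [w0|]; last first.
    by move=> /or3P[] /eqP ->; ring.
  have /eqP : (w - 9) * ((w - 18) * (w - - 6)) = 0 by lra.
  by rewrite !mulf_eq0 !subr_eq0.
Qed.
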